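(* Let $C,k,p\ge 1$ be integers and let $f$ be a model with trainable parameter $\boldsymbol{\theta}\in\mathbb{R}^p$ which assigns to each input a vector of $C+k$ real logits depending differentiably on $\boldsymbol{\theta}$. Let $(\boldsymbol{x},y)$ be an in-distribution sample with label $y\in\{1,\dots,C\}$ and let $\widetilde{\boldsymbol{x}}$ be an OOD sample. Put $\boldsymbol{z}=\mathrm{Softmax}(f(\boldsymbol{x}))$ and $\widetilde{\boldsymbol{z}}=\mathrm{Softmax}(f(\widetilde{\boldsymbol{x}}))$, and let $\ell$ be the cross-entropy loss. (1) The outlier loss $\ell(\widetilde{\boldsymbol{z}},\widetilde{y})$ with virtual label $\widetilde{y}=\arg\max_{c\in\{C+1,\dots,C+k\}} f_c(\widetilde{\boldsymbol{x}})$ induces on $\nabla_{\boldsymbol{\theta}}\ell(\boldsymbol{z},y)$ the gradient noise $$\boldsymbol{g}=-\frac{\nabla_{\boldsymbol{\theta}}\widetilde{\boldsymbol{z}}_j}{\widetilde{\boldsymbol{z}}_j}\in\mathbb{R}^p,\qquad j=\arg\max_{c\in\{C+1,\dots,C+k\}}\widetilde{\boldsymbol{z}}_c .$$ (2) With the Outlier Exposure (OE) loss in place of the virtual-label outlier loss, each OOD sample $\widetilde{\boldsymbol{x}}$ induces on $\nabla_{\boldsymbol{\theta}}\ell(\boldsymbol{z},y)$ the gradient noise $$\boldsymbol{g}'=-\frac{1}{C}\sum_{j=1}^{C}\frac{\nabla_{\boldsymbol{\theta}}\widetilde{\boldsymbol{z}}_j}{\widetilde{\boldsymbol{z}}_j}.$$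 Here $\frac{\cdot}{\widetilde{\boldsymbol{z}}_j}$ denotes element-wise division of a vector by the scalar $\widetilde{\boldsymbol{z}}_j$.
   Context: $C$ is the number of in-distribution classes (labelled $1,\dots,C$) and $k$ is the number of additional abstention classes (labelled $C+1,\dots,C+k$). $f_c(\cdot)$ is the logit of class $c$, and $\mathrm{Softmax}(u)_c=e^{u_c}/\sum_{c'}e^{u_{c'}}$. Cross-entropy loss: for a probability vector $\boldsymbol{z}$ and a class label $y$, $\ell(\boldsymbol{z},y)=-\log \boldsymbol{z}_y$; equivalently, in terms of logits, $\log\bigl[1+\sum_{y'\neq y}e^{f_{y'}(\boldsymbol{x})-f_y(\boldsymbol{x})}\bigr]$. Virtual-label outlier loss of an OOD sample $\widetilde{\boldsymbol{x}}$: $\ell(\widetilde{\boldsymbol{z}},\widetilde{y})$, where the virtual label $\widetilde{y}=\arg\max_{c\in\{C+1,\dots,C+k\}} f_c(\widetilde{\boldsymbol{x}})$ is produced by the current model (current value of $\boldsymbol{\theta}$) and then serves as a fixed target label, so it is held constant when the loss is differentiated in $\boldsymbol{\theta}$. The $\arg\max$ denotes a chosen maximizing index (the same choice for the logits $f_c(\widetilde{\boldsymbol{x}})$ and the probabilities $\widetilde{\boldsymbol{z}}_c$). OE outlier loss of an OOD sample: $\ell_{\mathrm{OE}}=-\frac{1}{C}\sum_{i=1}^{C}\log\widetilde{\boldsymbol{z}}_i$. Gradient noise: the total loss for the pair of samples is the in-distribution loss $\ell(\boldsymbol{z},y)$ plus the outlier loss of $\widetilde{\boldsymbol{x}}$ (trade-off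 weight taken to be $1$). The gradient noise induced on $\nabla_{\boldsymbol{\theta}}\ell(\boldsymbol{z},y)$ is the vector in $\mathbb{R}^p$ that the outlier loss adds to it in the gradient of the total loss, i.e. $\nabla_{\boldsymbol{\theta}}(\text{total loss})-\nabla_{\boldsymbol{\theta}}\ell(\boldsymbol{z},y)$, all gradients being evaluated at the current $\boldsymbol{\theta}$. *)

(* Defs.v *)
From HB Require Import structures.
From mathcomp Require Import all_boot all_order all_algebra.
From mathcomp Require Import all_classical all_reals all_analysis.

Set Implicit Arguments.
Unset Strict Implicit.
Unset Printing Implicit Defensive.

Import Order.TTheory GRing.Theory Num.Theory.
Import numFieldNormedType.Exports.

Local Open Scope ring_scope.

Definition gradient (R : realType) (p : nat) (L : 'rV[R]_p -> R)
    (theta : 'rV[R]_p) : 'rV[R]_p :=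
  \row_(i < p) 'D_(delta_mx 0 i) L theta.

Definition softmax (R : realType) (n : nat) (u : 'rV[R]_n) : 'rV[R]_n :=
  \row_(c < n) (expR (u 0 c) / \sum_(c' < n) expR (u 0 c')).

Definition cross_entropy (R : realType) (n : nat) (z : 'rV[R]_n) (y : 'I_n) : R :=
  - ln (z 0 y).

(* The classes are indexed by 'I_(C + k): [lshift k i] (i : 'I_C) is an
   in-distribution class and [rshift C i] (i : 'I_k) an abstention class. *)
Definition oe_loss (R : realType) (C k : nat) (z : 'rV[R]_(C + k)) : R :=
  - (C%:R^-1 * \sum_(i < C) ln (z 0 (lshift k i))).

Definition abstention_classes (C k : nat) : {set 'I_(C + k)} :=
  [set rshift C i | i : 'I_k].

Definition maximizers (R : realType) (n : nat) (A : {set 'I_n}) (u : 'rV[R]_n) :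
    {set 'I_n} :=
  [set c in A | [forall c' in A, u 0 c' <= u 0 c]].

(* A tie-breaking rule picks one index out of each nonempty set of indices. *)
Definition tie_breaking (n : nat) (sel : {set 'I_n} -> 'I_n) : Prop :=
  forall B : {set 'I_n}, B != finset.set0 -> sel B \in B.

Definition argmax (R : realType) (n : nat) (sel : {set 'I_n} -> 'I_n)
    (A : {set 'I_n}) (u : 'rV[R]_n) : 'I_n :=
  sel (maximizers A u).

Definition gradient_noise (R : realType) (p : nat) (Lin Lout : 'rV[R]_p -> R)
    (theta : 'rV[R]_p) : 'rV[R]_p :=
  gradient (fun t => Lin t + Lout t) theta - gradient Lin theta.

(* Main.v *)
Require Import Defs.
From HB Require Import structures.
From mathcomp Require Import all_boot all_order all_algebra.
From mathcomp Require Import all_classical all_reals all_analysis.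

Set Implicit Arguments.
Unset Strict Implicit.
Unset Printing Implicit Defensive.

Import Order.TTheory GRing.Theory Num.Theory.
Import numFieldNormedType.Exports.

Local Open Scope ring_scope.

(* The outlier losses are combinations of logarithms of softmax entries, which
   are positive and differentiable in theta, so the claims reduce to linearity
   of the gradient and the logarithmic derivative grad (ln g) = g^-1 grad g.
   The two argmax indices agree because softmax preserves the order of the
   logits: both sets of maximizers coincide, so any tie-breaking rule picks the
   same index. *)

Lemma gradientD (R : realType) (p : nat) (L M : 'rV[R]_p -> R)
    (theta : 'rV[R]_p) :
  differentiable L theta -> differentiable M theta ->
  gradient (fun t => L t + M t) theta = gradient L theta + gradient M theta.
Proof.
move=> dL dM; apply/rowP => i; rewrite !mxE.
by rewrite -deriveD//; exact: diff_derivable.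
Qed.

Lemma gradientZ (R : realType) (p : nat) (a : R) (L : 'rV[R]_p -> R)
    (theta : 'rV[R]_p) :
  differentiable L theta ->
  gradient (fun t => a * L t) theta = a *: gradient L theta.
Proof.
move=> dL; apply/rowP => i; rewrite !mxE.
(* On scalars [a * L t] and [a *: L t] are convertible, so [deriveZ] applies as is. *)
have := @deriveZ _ _ _ L a theta (delta_mx 0 i).
by apply; exact: diff_derivable.
Qed.

Lemma gradientN (R : realType) (p : nat) (L : 'rV[R]_p -> R)
    (theta : 'rV[R]_p) :
  differentiable L theta ->
  gradient (fun t => - L t) theta = - gradient L theta.
Proof.
move=> dL; rewrite -scaleN1r -gradientZ//; congr gradient.
by apply/funext => t; rewrite mulN1r.
Qed.

Lemma gradient_sum (R : realType) (p n : nat) (L : 'I_n -> 'rV[R]_p -> R)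
    (theta : 'rV[R]_p) :
  (forall i, differentiable (L i) theta) ->
  gradient (fun t => \sum_(i < n) L i t) theta
    = \sum_(i < n) gradient (L i) theta.
Proof.
move=> dL; apply/rowP => i; rewrite summxE !mxE.
have -> : (fun t => \sum_(i < n) L i t) = \sum_(i < n) L i.
  by apply/funext => t; rewrite fct_sumE.
rewrite derive_sum; first by apply: eq_bigr => c _; rewrite mxE.
by move=> c; exact: diff_derivable.
Qed.

Lemma differentiable_ln (R : realType) (x : R) :
  0 < x -> differentiable (@ln R) x.
Proof. by move=> x0; apply/derivable1_diffP; have [] := is_derive1_ln x0. Qed.

Lemma differentiable_ln_comp (R : realType) (p : nat) (g : 'rV[R]_p -> R)
    (theta : 'rV[R]_p) :
  differentiable g theta -> 0 < g theta ->
  differentiable (fun t => ln (g t)) theta.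
Proof.
by move=> dg g0; apply: differentiable_comp => //; exact: differentiable_ln.
Qed.

Lemma gradient_ln_comp (R : realType) (p : nat) (g : 'rV[R]_p -> R)
    (theta : 'rV[R]_p) :
  differentiable g theta -> 0 < g theta ->
  gradient (fun t => ln (g t)) theta = (g theta)^-1 *: gradient g theta.
Proof.
move=> dg g0; have dln := differentiable_ln g0.
apply/rowP => i; rewrite !mxE deriveE; last exact: differentiable_ln_comp.
(* Chain rule: the differential of [ln] at [g theta] is multiplication by its derivative there,
   namely [(g theta)^-1]. *)
rewrite (@diff_comp _ _ _ _ g (@ln R))//= diff1E// derive1E.
have [_ ->] := is_derive1_ln g0.
by rewrite -deriveE// mulrC.
Qed.

(** The index [c] witnesses [n > 0]; an empty sum would be zero. *)
Lemma sum_expR_gt0 (R : realType) (n : nat) (u : 'rV[R]_n) (c : 'I_n) :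
  0 < \sum_(c' < n) expR (u 0 c').
Proof. by rewrite (bigD1 c)//= ltr_pwDl ?expR_gt0// sumr_ge0. Qed.

Lemma softmax_gt0 (R : realType) (n : nat) (u : 'rV[R]_n) (c : 'I_n) :
  0 < softmax u 0 c.
Proof. by rewrite mxE divr_gt0 ?expR_gt0// (sum_expR_gt0 _ c). Qed.

(** Both entries share one positive denominator, which cancels, and the exponential is
    increasing. *)
Lemma ler_softmax (R : realType) (n : nat) (u : 'rV[R]_n) (c c' : 'I_n) :
  (softmax u 0 c <= softmax u 0 c') = (u 0 c <= u 0 c').
Proof.
by rewrite !mxE ler_pM2r ?ler_expR// invr_gt0 (sum_expR_gt0 _ c).
Qed.

Lemma argmax_softmax (R : realType) (n : nat) (sel : {set 'I_n} -> 'I_n)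
    (A : {set 'I_n}) (u : 'rV[R]_n) :
  argmax sel A (softmax u) = argmax sel A u.
Proof.
congr sel; apply/setP => c; rewrite !inE; congr (_ && _).
by apply: eq_forallb => c'; rewrite ler_softmax.
Qed.

Lemma differentiable_softmax (R : realType) (p n : nat)
    (u : 'rV[R]_p -> 'rV[R]_n) (theta : 'rV[R]_p) (c : 'I_n) :
  differentiable u theta ->
  differentiable (fun t => softmax (u t) 0 c) theta.
Proof.
move=> du.
have dexp c' : differentiable (fun t => expR (u t 0 c')) theta.
  apply: (@differentiable_comp _ _ _ _ (fun t => u t 0 c') (@expR R)).
    apply: (@differentiable_comp _ _ _ _ u (fun M => M 0 c')) => //.
    exact: differentiable_coord.
  exact/derivable1_diffP/derivable_expR.
(* The denominator is formed as a sum of functions, the shape [differentiable_sum] expects; [SE]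
   gives its pointwise value. *)
pose S := \sum_(c' < n) (fun t => expR (u t 0 c')).
have SE t : S t = \sum_(c' < n) expR (u t 0 c') by rewrite /S fct_sumE.
have dS : differentiable S theta by exact: differentiable_sum.
have -> : (fun t => softmax (u t) 0 c) =
    (fun t => expR (u t 0 c)) * (fun t => (S t)^-1).
  by apply/funext => t; rewrite mxE -SE.
apply: differentiableM => //; apply: differentiableV => //.
by rewrite SE gt_eqF// (sum_expR_gt0 _ c).
Qed.

(** By additivity the in-distribution gradient cancels, so each claim becomes the computation of one
    outlier gradient. *)
Lemma gradient_noiseE (R : realType) (p : nat) (Lin Lout : 'rV[R]_p -> R)
    (theta : 'rV[R]_p) :
  differentiable Lin theta -> differentiable Lout theta ->
  gradient_noise Lin Lout theta = gradient Lout theta.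
Proof. by move=> dLin dLout; rewrite /gradient_noise gradientD// addrC addKr. Qed.

Theorem proposition1 (R : realType) (C k p : nat)
    (hC : (1 <= C)%N) (hk : (1 <= k)%N) (hp : (1 <= p)%N)
    (X : Type) (f : X -> 'rV[R]_p -> 'rV[R]_(C + k))
    (f_diff : forall (x : X) (theta : 'rV[R]_p), differentiable (f x) theta)
    (sel : {set 'I_(C + k)} -> 'I_(C + k)) (sel_tie : tie_breaking sel)
    (x : X) (y : 'I_C) (xt : X) (theta : 'rV[R]_p) :
  let z := fun t : 'rV[R]_p => softmax (f x t) in
  let zt := fun t : 'rV[R]_p => softmax (f xt t) in
  (* the virtual label is computed at the current [theta] and then frozen *)
  let yt := argmax sel (abstention_classes C k) (f xt theta) in
  let j := argmax sel (abstention_classes C k) (zt theta) in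
  gradient_noise (fun t => cross_entropy (z t) (lshift k y))
                 (fun t => cross_entropy (zt t) yt) theta
    = - ((zt theta 0 j)^-1 *: gradient (fun t => zt t 0 j) theta)
  /\
  gradient_noise (fun t => cross_entropy (z t) (lshift k y))
                 (fun t => oe_loss (zt t)) theta
    = - (C%:R^-1 *: \sum_(i < C)
           ((zt theta 0 (lshift k i))^-1
              *: gradient (fun t => zt t 0 (lshift k i)) theta)).
Proof.
move=> z zt yt j.
have dln s c : differentiable (fun t => ln (softmax (f s t) 0 c)) theta.
  by apply: differentiable_ln_comp; [exact: differentiable_softmax|
                                    exact: softmax_gt0].
have gln c : gradient (fun t => ln (zt t 0 c)) theta
    = (zt theta 0 c)^-1 *: gradient (fun t => zt t 0 c) theta.
  by apply: gradient_ln_comp; [exact: differentiable_softmax|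
                              exact: softmax_gt0].
have dCE s c :
    differentiable (fun t => cross_entropy (softmax (f s t)) c) theta.
  exact: differentiableN.
(* Both indices are taken at the fixed [theta], so the label stays constant in the differentiation
   variable [t]. *)
have -> : j = yt by exact: argmax_softmax.
split.
  rewrite gradient_noiseE; [|exact: dCE..].
  by rewrite -gln; apply: gradientN; exact: dln.
(* With this [S], [oe_loss (zt t)] unfolds to [- (C%:R^-1 * S t)], so the gradient rules for
   opposite, scaling and sum apply in turn. *)
pose S t := \sum_(i < C) ln (zt t 0 (lshift k i)).
have dS : differentiable S theta.
  have -> : S = \sum_(i < C) (fun t => ln (zt t 0 (lshift k i))).
    by apply/funext => t; rewrite fct_sumE.
  by apply: differentiable_sum => i; exact: dln.
have dCS : differentiable (fun t => C%:R^-1 * S t) theta.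
  exact: differentiableZ.
rewrite gradient_noiseE; [|exact: dCE|exact: differentiableN].
rewrite [LHS]gradientN// gradientZ// gradient_sum; last by move=> i; exact: dln.
by under eq_bigr do rewrite gln.
Qed.
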